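(* Let $\alpha\in\mathbb{Z}[\mathbb{Z}^\circ]$, let $d>1$ be an integer, and let $f(x)\in\mathbb{Q}(x)$ be a rational function. Suppose that $\phi_d(\alpha)=0$ and that $f$ is defined at $\zeta_d^m$ for every $m\in\operatorname{Supp}(\alpha)$. Then $\Phi_d$ is a factor of $\alpha f$.
   Context: $\mathbb{Z}^\circ$ is the multiplicative monoid of nonzero integers, and $\mathbb{Z}[\mathbb{Z}^\circ]$ is its integral monoid ring: finite formal sums $\alpha=\sum_m a_m[m]$ with $a_m\in\mathbb{Z}$, and multiplication extending $[m][n]=[mn]$. $\operatorname{Supp}(\alpha)=\{m : a_m\neq 0\}$. The ring $\mathbb{Z}[\mathbb{Z}^\circ]$ acts on $\mathbb{Q}(x)$ by $(\alpha f)(x)=\sum_m a_m f(x^m)$. $(\mathbb{Z}/d)^\circ$ is the multiplicative monoid of all residue classes mod $d$ (including $0$), and $\phi_d:\mathbb{Z}[\mathbb{Z}^\circ]\to\mathbb{Z}[(\mathbb{Z}/d)^\circ]$ is the ring homomorphism induced by $[m]\mapsto[m \bmod d]$. $\zeta_d$ is a primitive $d$-th root of unity in $\mathbb{C}$ and $\Phi_d$ is the $d$-th cyclotomic polynomial. $F\in\mathbb{Q}(x)$ is defined at $\xi\in\mathbb{C}$ if $\xi$ is not a pole of $F$. $\Phi_d$ is a factor of $F$ if $F=P/Q$ with $P,Q\in\mathbb{Q}[x]$, $\Phi_d\mid P$ and $\Phi_d\nmid Q$; equivalently, $F$ is defined at $\zeta_d$ and $F(\zeta_d)=0$. *)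

(* Defs.v *)
From HB Require Import structures.
From mathcomp Require Import all_boot all_order all_algebra all_field.
From mathcomp Require Import finmap.
From mathcomp.multinomials Require Import monalg.
Set Implicit Arguments.
Unset Strict Implicit.
Unset Printing Implicit Defensive.
Import Order.TTheory GRing.Theory Num.Theory.
Local Open Scope ring_scope.

(* Z-linear extension of h : K -> V to finite formal sums of elements of K. *)
Section LinearExtension.
Context {K : choiceType} {V : zmodType}.

Definition zext (h : K -> V) (a : {malg int[K]}) : V :=
  \sum_(k <- msupp a) h k *~ a@_k.

Lemma zextEw (h : K -> V) (a : {malg int[K]}) (D : {fset K}) :
  (msupp a `<=` D)%fset -> zext h a = \sum_(k <- D) h k *~ a@_k.
Proof.
by move=> le; rewrite [LHS](big_fset_incl _ le) //= => x _ /mcoeff_outdom ->.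
Qed.

Lemma zext_is_zmod_morphism (h : K -> V) : zmod_morphism (zext h).
Proof.
move=> a b; pose D := (msupp a `|` msupp b)%fset.
rewrite (@zextEw _ (a - b) D) ?msuppB_le //.
rewrite (@zextEw _ a D) ?fsubsetUl // (@zextEw _ b D) ?fsubsetUr //.
by rewrite -sumrB; apply: eq_bigr => k _; rewrite mcoeffB mulrzBr.
Qed.

HB.instance Definition _ (h : K -> V) :=
  GRing.isZmodMorphism.Build {malg int[K]} V (zext h)
    (zext_is_zmod_morphism h).

Lemma zextU (h : K -> V) k : zext h << 1 *g k >> = h k.
Proof. by rewrite (zextEw _ msuppU_le) big_seq_fset1 mcoeffUU. Qed.

Lemma eq_zext (h h' : K -> V) : h =1 h' -> zext h =1 zext h'.
Proof. by move=> e a; apply: eq_bigr => k _; rewrite e. Qed.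

End LinearExtension.

Lemma raddf_zext (K : choiceType) (V W : zmodType) (F : {additive V -> W})
  (h : K -> V) a : F (zext h a) = zext (F \o h) a.
Proof. by rewrite raddf_sum; apply: eq_bigr => k _; rewrite raddfMz. Qed.

Lemma zext_exchange (K L : choiceType) (V : zmodType) (h : K -> L -> V) a b :
  zext (fun k => zext (h k) b) a = zext (fun l => zext (h^~ l) a) b.
Proof.
rewrite /zext (eq_bigr _ (fun k _ => mulrz_suml _ _ _ _)) exchange_big.
apply: eq_bigr => l _; rewrite mulrz_suml; apply: eq_bigr => k _.
by rewrite -!mulrzA mulrC.
Qed.

Lemma zext_id (K : choiceType) (a : {malg int[K]}) :
  zext (fun k => << 1 *g k >>) a = a.
Proof.
rewrite [RHS]monalgE; apply: eq_bigr => k _.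
by rewrite -[in RHS](intz a@_k) -(raddfMz (mkmalgU k)).
Qed.

Lemma zext_mulr (K : choiceType) (R : pzRingType) (h : K -> R) (x : R) a :
  x * zext h a = zext (fun k => x * h k) a.
Proof. by rewrite mulr_sumr; apply: eq_bigr => k _; rewrite mulrzAr. Qed.

Lemma zext_mull (K : choiceType) (R : pzRingType) (h : K -> R) (x : R) a :
  zext h a * x = zext (fun k => h k * x) a.
Proof. by rewrite mulr_suml; apply: eq_bigr => k _; rewrite mulrzAl. Qed.

(* The multinomials library equips {malg int[K]} with a product only when 1 has
   no nontrivial factorization in K, which excludes monoids containing -1. *)
Definition monring (K : choiceType) (e : K) (op : Monoid.com_law e) : Type :=
  {malg int[K]}.

Section MonoidRing.
Context (K : choiceType) (e : K) (op : Monoid.com_law e).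

HB.instance Definition _ := GRing.Zmodule.on (monring op).

Definition mrone : monring op := << 1 *g e >>.

Definition mrmul (a b : monring op) : monring op :=
  zext (fun k => zext (fun l => << 1 *g op k l >> : monring op) b) a.

Fact mrmulC : commutative mrmul.
Proof.
move=> a b; rewrite /mrmul zext_exchange; apply: eq_zext => l.
by apply: eq_zext => k; rewrite Monoid.mulmC.
Qed.

Fact mrmulDl : left_distributive mrmul +%R.
Proof. by move=> a b c; rewrite /mrmul raddfD. Qed.

Fact mrmulDr : right_distributive mrmul +%R.
Proof. by move=> a b c; rewrite mrmulC mrmulDl ![mrmul _ a]mrmulC. Qed.

Fact mrmulA : associative mrmul.
Proof.
move=> a b c; rewrite [RHS]/mrmul [X in zext _ X]/mrmul raddf_zext.
apply: eq_zext => k /=; rewrite /mrmul !raddf_zext.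
apply: eq_zext => l /=; rewrite zextU !raddf_zext.
by apply: eq_zext => m /=; rewrite zextU Monoid.mulmA.
Qed.

Fact mrmul1 : left_id mrone mrmul.
Proof.
move=> a; rewrite /mrmul zextU -[RHS]zext_id.
by apply: eq_zext => k; rewrite Monoid.mul1m.
Qed.

Fact mrone_neq0 : mrone != 0.
Proof. by rewrite monalgU_eq0. Qed.

HB.instance Definition _ := GRing.Zmodule_isComNzRing.Build (monring op)
  mrmulA mrmulC mrmul1 mrmulDl mrone_neq0.

Lemma mrmulUU k l :
  (<< 1 *g k >> : monring op) * (<< 1 *g l >> : monring op) =
  << 1 *g op k l >>.
Proof. by rewrite -[LHS]/(mrmul _ _) /mrmul !zextU. Qed.
End MonoidRing.

Record nzint := NzInt { nzval :> int; _ : nzval != 0 }.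
HB.instance Definition _ := [isSub for nzval].
HB.instance Definition _ := [Choice of nzint by <:].

Lemma nzint_neq0 (m : nzint) : (m : int) != 0.
Proof. by case: m. Qed.

Definition nz1 : nzint := @NzInt 1 isT.
Definition nzmul (m n : nzint) : nzint :=
  NzInt (mulf_neq0 (nzint_neq0 m) (nzint_neq0 n)).

Fact nzmulA : associative nzmul.
Proof. by move=> m n p; apply: val_inj; apply: mulrA. Qed.
Fact nzmulC : commutative nzmul.
Proof. by move=> m n; apply: val_inj; apply: mulrC. Qed.
Fact nzmul1 : left_id nz1 nzmul.
Proof. by move=> m; apply: val_inj; apply: mul1r. Qed.

HB.instance Definition _ :=
  Monoid.isComLaw.Build nzint nz1 nzmul nzmulA nzmulC nzmul1.

Notation ZZo := (monring nzmul).
(* 'Z_d is Z/d only when 1 < d. *)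
Notation ZZdo d := (monring (@GRing.mul 'Z_d)).

Definition residue (d : nat) (m : nzint) : 'Z_d := (m : int)%:~R.

Definition phi (d : nat) (a : ZZo) : ZZdo d :=
  zext (fun m : nzint => << 1 *g residue d m >> : ZZdo d) a.

Lemma phi_is_zmod_morphism d : zmod_morphism (phi d).
Proof. by move=> a b; rewrite /phi raddfB. Qed.
HB.instance Definition _ d :=
  GRing.isZmodMorphism.Build ZZo (ZZdo d) (phi d) (phi_is_zmod_morphism d).

Lemma phi_is_monoid_morphism d : monoid_morphism (phi d).
Proof.
split=> [|a b]; first by rewrite /phi zextU.
rewrite -[a * b]/(mrmul a b) /mrmul [phi d a]/phi zext_mull raddf_zext.
apply: eq_zext => k /=; rewrite [phi d b]/phi zext_mulr raddf_zext.
apply: eq_zext => l /=.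
by rewrite /phi zextU mrmulUU /residue /= intrM.
Qed.
HB.instance Definition _ d :=
  GRing.isMonoidMorphism.Build ZZo (ZZdo d) (phi d) (phi_is_monoid_morphism d).

Notation Qx := {fraction {poly rat}}.
Notation "p %:F" := (@FracField.tofrac _ p).

Definition Qx_const (c : rat) : Qx := c%:P%:F.

HB.instance Definition _ := GRing.RMorphism.copy Qx_const
  (@FracField.tofrac {poly rat} \o polyC).

Definition polysubst (t : Qx) (p : {poly rat}) : Qx :=
  (map_poly Qx_const p).[t].

HB.instance Definition _ t := GRing.RMorphism.copy (polysubst t)
  (horner_eval t \o map_poly Qx_const).

Lemma QxE (f : Qx) : f = (\n_(repr f))%:F / (\d_(repr f))%:F.
Proof.
have d0 : (\d_(repr f))%:F != 0 :> Qx by rewrite tofrac_eq0 denom_ratioP.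
apply: (mulIf d0); rewrite divfK // -{1}[f]reprK.
unlock FracField.tofrac; rewrite -[LHS]/(FracField.mul _ _) -FracField.pi_mul.
apply/eqmodP; rewrite /= FracField.equivfE /FracField.mulf.
rewrite !numden_Ratio ?oner_eq0 ?mulr1 ?denom_ratioP // mulrC.
by [].
Qed.

(* f(x^m), for a rational function f written as a quotient of polynomials; the
   result does not depend on the quotient chosen (see powsubstE). *)
Definition powsubst (m : nzint) (f : Qx) : Qx :=
  polysubst ('X%:F ^ (m : int)) \n_(repr f) /
  polysubst ('X%:F ^ (m : int)) \d_(repr f).

Lemma polysubstXn n p : polysubst ('X%:F ^+ n) p = (p \Po 'X^n)%:F.
Proof.
rewrite /polysubst comp_polyE horner_coef size_map_poly rmorph_sum.
apply: eq_bigr => i _; rewrite coef_map -mul_polyC rmorphM !rmorphXn.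
by [].
Qed.

Lemma polysubst_pow_neq0 (m : nzint) (p : {poly rat}) :
  p != 0 -> polysubst ('X%:F ^ (m : int)) p != 0.
Proof.
have pos n q : (0 < n)%N -> q != 0 -> polysubst ('X%:F ^+ n) q != 0.
  move=> n0 q0; rewrite polysubstXn tofrac_eq0.
  by rewrite comp_poly_eq0 // size_polyXn ltnS.
case: m => -[n|n] /= nz p0; first by rewrite -exprnP pos // lt0n.
apply/negP => pz.
have [] : algebraicOver Qx_const ('X%:F ^+ n.+1).
  rewrite -[_ ^+ _]invrK; apply: algebraic_inv; exists p => //.
move=> q q0; rewrite /root -/(polysubst _ q); apply/negP.
exact: pos.
Qed.

Lemma powsubstE (m : nzint) (P Q : {poly rat}) : Q != 0 ->
  powsubst m (P%:F / Q%:F) =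
  polysubst ('X%:F ^ (m : int)) P / polysubst ('X%:F ^ (m : int)) Q.
Proof.
move=> Q0; rewrite /powsubst; set f := P%:F / Q%:F.
have d0 : \d_(repr f) != 0 by apply: denom_ratioP.
have /eqP := QxE f; rewrite {1}/f eqr_div ?tofrac_eq0 // -!tofracM tofrac_eq.
move=> /eqP e; apply/eqP; rewrite eqr_div ?polysubst_pow_neq0 //.
by rewrite -!rmorphM /= e.
Qed.

Lemma Qx_ind (T : Qx -> Prop) :
  (forall P Q : {poly rat}, Q != 0 -> T (P%:F / Q%:F)) -> forall f, T f.
Proof. by move=> h f; rewrite (QxE f); apply/h/denom_ratioP. Qed.

Lemma powsubst_poly m p : powsubst m p%:F = polysubst ('X%:F ^ (m : int)) p.
Proof.
by rewrite -[p%:F]divr1 -tofrac1 powsubstE ?oner_eq0 // rmorph1 divr1.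
Qed.

Lemma powsubst_is_monoid_morphism m : monoid_morphism (powsubst m).
Proof.
split=> [|f g]; first by rewrite -tofrac1 powsubst_poly rmorph1.
elim/Qx_ind: f => P Q Q0; elim/Qx_ind: g => R S S0.
rewrite mulf_div -!tofracM !powsubstE ?mulf_neq0 //.
by rewrite !rmorphM mulf_div.
Qed.

Lemma powsubst_is_zmod_morphism m : zmod_morphism (powsubst m).
Proof.
move=> f g; elim/Qx_ind: f => P Q Q0; elim/Qx_ind: g => R S S0.
rewrite -mulNr addf_div ?tofrac_eq0 // -tofracN -!tofracM -tofracD.
rewrite !powsubstE ?mulf_neq0 // -mulNr addf_div ?polysubst_pow_neq0 //.
by rewrite rmorphD !rmorphM rmorphN.
Qed.

HB.instance Definition _ m := GRing.isZmodMorphism.Build Qx Qx (powsubst m)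
  (powsubst_is_zmod_morphism m).
HB.instance Definition _ m := GRing.isMonoidMorphism.Build Qx Qx (powsubst m)
  (powsubst_is_monoid_morphism m).

Lemma powsubst_polysubst m t p :
  powsubst m (polysubst t p) = polysubst (powsubst m t) p.
Proof.
rewrite /polysubst -horner_map -map_poly_comp; congr (_.[_]).
by apply: eq_map_poly => c /=; rewrite powsubst_poly /polysubst map_polyC hornerC.
Qed.

Lemma powsubst_comp m n f : powsubst m (powsubst n f) = powsubst (nzmul m n) f.
Proof.
elim/Qx_ind: f => P Q Q0; rewrite !powsubstE // fmorph_div /=.
have e : powsubst m ('X%:F ^ (n : int)) = 'X%:F ^ (nzmul m n : int).
  by rewrite fmorphXz /= powsubst_poly /polysubst map_polyX hornerX exprz_exp.
by rewrite !powsubst_polysubst e.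
Qed.

Lemma powsubst1 f : powsubst nz1 f = f.
Proof.
elim/Qx_ind: f => P Q Q0; rewrite powsubstE //.
have e p : polysubst ('X%:F ^ 1) p = p%:F.
  by rewrite -exprnP polysubstXn comp_polyXr.
by rewrite !e.
Qed.

Definition powact (a : ZZo) (f : Qx) : Qx :=
  zext (fun m => powsubst m f) a.

Lemma powact_is_zmod_morphism a : zmod_morphism (powact a).
Proof.
move=> f g; rewrite /powact /zext -sumrB; apply: eq_bigr => m _.
by rewrite rmorphB mulrzBl.
Qed.
HB.instance Definition _ a := GRing.isZmodMorphism.Build Qx Qx (powact a)
  (powact_is_zmod_morphism a).

Lemma powact1 f : powact 1 f = f.
Proof. by rewrite /powact zextU powsubst1. Qed.

Lemma powactM a b f : powact (a * b) f = powact a (powact b f).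
Proof.
rewrite -[a * b]/(mrmul a b) /mrmul /powact raddf_zext; apply: eq_zext => m /=.
rewrite !raddf_zext; apply: eq_zext => n /=.
by rewrite zextU powsubst_comp.
Qed.

(* xi is not a pole of F: the denominator of F in lowest terms divides every
   other denominator, so it is enough that some denominator does not vanish. *)
Definition defined_at (C : numClosedFieldType) (F : Qx) (xi : C) : Prop :=
  exists P Q : {poly rat},
    F = P%:F / Q%:F /\ (map_poly ratr Q).[xi] != 0.

Definition Phi (d : nat) : {poly rat} := map_poly intr 'Phi_d.

Definition is_factor (p : {poly rat}) (F : Qx) : Prop :=
  exists P Q : {poly rat}, [/\ F = P%:F / Q%:F, p %| P & ~~ (p %| Q)].

(* Main.v *)
From HB Require Import structures.
Require Import Defs.
From mathcomp Require Import all_boot all_order all_algebra all_field.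
From mathcomp Require Import finmap.
From mathcomp.multinomials Require Import monalg.
Import Order.TTheory GRing.Theory Num.Theory.
Local Open Scope ring_scope.

(** If f is defined at zeta^m then f(x^m) takes the value f(zeta^m) at zeta, so
    alpha f takes at zeta the value sum_m a_m f(zeta^m).  Since f(zeta^m) depends
    only on m mod d, this is the image of phi_d(alpha) = 0 under a linear map.
    Finally Phi_d is irreducible over Q, so it divides every rational polynomial
    vanishing at zeta. *)

Section Values.
Context {K : numFieldType}.

Definition ratpoly_eval (x : K) (p : {poly rat}) : K := (map_poly ratr p).[x].

HB.instance Definition _ x := GRing.RMorphism.copy (ratpoly_eval x)
  (horner_eval x \o map_poly (@ratr K)).

Lemma ratpoly_evalC x c : ratpoly_eval x c%:P = ratr c.
Proof. by rewrite /ratpoly_eval map_polyC hornerC. Qed.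

Lemma ratpoly_evalX x : ratpoly_eval x 'X = x.
Proof. by rewrite /ratpoly_eval map_polyX hornerX. Qed.

Lemma ratpoly_eval_neq0 {x p} : ratpoly_eval x p != 0 -> p != 0.
Proof. by apply: contraNneq => ->; rewrite rmorph0. Qed.

(** A relation witnessed by any one fraction, so that sums, products and inverses follow by
    exhibiting a new fraction, not necessarily in lowest terms. *)
Definition takes_value (f : Qx) (x v : K) : Prop :=
  exists P Q : {poly rat}, [/\ f = P%:F / Q%:F, ratpoly_eval x Q != 0
    & v = ratpoly_eval x P / ratpoly_eval x Q].

Lemma takes_value_poly p x : takes_value p%:F x (ratpoly_eval x p).
Proof. by exists p, 1; rewrite tofrac1 rmorph1 !divr1 oner_eq0. Qed.

Lemma takes_valueD f g x v w :
  takes_value f x v -> takes_value g x w -> takes_value (f + g) x (v + w).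
Proof.
move=> [P [Q [-> Q0 ->]]] [R [S [-> S0 ->]]].
exists (P * S + R * Q), (Q * S); split; last 1 first.
- by rewrite addf_div // rmorphD !rmorphM.
- rewrite addf_div ?tofrac_eq0 ?(ratpoly_eval_neq0 Q0) ?(ratpoly_eval_neq0 S0) //.
  by rewrite -!tofracM -tofracD.
- by rewrite rmorphM mulf_neq0.
Qed.

Lemma takes_valueM f g x v w :
  takes_value f x v -> takes_value g x w -> takes_value (f * g) x (v * w).
Proof.
move=> [P [Q [-> Q0 ->]]] [R [S [-> S0 ->]]].
exists (P * R), (Q * S); split; last 1 first.
- by rewrite !rmorphM mulf_div.
- by rewrite mulf_div -!tofracM.
- by rewrite rmorphM mulf_neq0.
Qed.

Lemma takes_valueV f x v :
  v != 0 -> takes_value f x v -> takes_value f^-1 x v^-1.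
Proof.
move=> v0 [P [Q [-> Q0 e]]]; exists Q, P.
(* A nonzero value forces [P] to be nonzero at [x], so [Q / P] is an admissible fraction. *)
by move: v0; rewrite e !invf_div mulf_eq0 negb_or => /andP[].
Qed.

Lemma takes_value_mulrz f x v (z : int) :
  takes_value f x v -> takes_value (f *~ z) x (v *~ z).
Proof.
move=> fv; rewrite -[f *~ z]mulrzr -[v *~ z]mulrzr; apply: takes_valueM => //.
by have := takes_value_poly z%:~R x; rewrite !rmorph_int.
Qed.

Lemma takes_valueX f x v n :
  takes_value f x v -> takes_value (f ^+ n) x (v ^+ n).
Proof.
move=> fv; elim: n => [|n IHn]; last by rewrite !exprS; apply: takes_valueM.
by have := takes_value_poly 1 x; rewrite tofrac1 rmorph1.
Qed.

Lemma takes_valueXz f x v (z : int) :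
  v != 0 -> takes_value f x v -> takes_value (f ^ z) x (v ^ z).
Proof.
move=> v0 fv; case: z => n; first exact: takes_valueX.
by apply: takes_valueV; [rewrite expf_neq0 | apply: takes_valueX].
Qed.

Lemma takes_value_polysubst t x v p :
  takes_value t x v -> takes_value (polysubst t p) x (ratpoly_eval v p).
Proof.
move=> tv; elim/poly_ind: p => [|p c IHp].
  by rewrite !rmorph0 -tofrac0 -(rmorph0 (ratpoly_eval x)); apply: takes_value_poly.
rewrite !rmorphD !rmorphM /= ratpoly_evalX ratpoly_evalC.
rewrite {2 3}/polysubst map_polyX hornerX map_polyC hornerC.
apply: takes_valueD; first exact: takes_valueM.
by rewrite -(ratpoly_evalC x); apply: takes_value_poly.
Qed.

(** Since [x != 0], negative exponents [m] are covered as well. *)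
Lemma takes_value_powsubst (m : nzint) P Q x :
  x != 0 -> ratpoly_eval (x ^ (m : int)) Q != 0 ->
  takes_value (powsubst m (P%:F / Q%:F)) x
    (ratpoly_eval (x ^ (m : int)) P / ratpoly_eval (x ^ (m : int)) Q).
Proof.
move=> x0 Qx0; rewrite powsubstE ?(ratpoly_eval_neq0 Qx0) //.
have Xm : takes_value ('X%:F ^ (m : int)) x (x ^ (m : int)).
  apply: takes_valueXz => //.
  by rewrite -{2}(ratpoly_evalX x); apply: takes_value_poly.
apply: takes_valueM; first exact: takes_value_polysubst.
by apply: takes_valueV => //; apply: takes_value_polysubst.
Qed.

Lemma takes_value_powact (a : ZZo) f x (v : nzint -> K) :
  (forall m, m \in msupp a -> takes_value (powsubst m f) x (v m)) ->
  takes_value (powact a f) x (zext v a).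
Proof.
move=> av; rewrite /powact /zext big_seq [X in takes_value _ _ X]big_seq.
apply: (big_ind2 (fun g w => takes_value g x w)).
- by rewrite -tofrac0 -(rmorph0 (ratpoly_eval x)); apply: takes_value_poly.
- by move=> g w g' w'; apply: takes_valueD.
- by move=> m /av; apply: takes_value_mulrz.
Qed.

End Values.

(** Being defined at a point provides a fraction that may vary with the point; lowest terms give one
    fraction that serves for all the [zeta ^ m] at once. *)
Lemma Qx_coprimeE (f : Qx) :
  exists P Q : {poly rat}, [/\ f = P%:F / Q%:F, Q != 0 & coprimep P Q].
Proof.
elim/Qx_ind: f => P Q Q0.
have Q0' : Q %/ gcdp P Q != 0 by rewrite dvdp_div_eq0 ?dvdp_gcdr.
exists (P %/ gcdp P Q), (Q %/ gcdp P Q); split=> //.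
  apply/eqP; rewrite eqr_div ?tofrac_eq0 // -!tofracM tofrac_eq.
  have := divpK (dvdp_gcdr P Q); have := divpK (dvdp_gcdl P Q).
  set g := gcdp P Q; set A := P %/ g; set B := Q %/ g => <- <-.
  by rewrite mulrAC mulrA.
by rewrite coprimep_div_gcd // Q0 orbT.
Qed.

Lemma defined_at_coprime (C : numClosedFieldType) (P Q : {poly rat}) (xi : C) :
  Q != 0 -> coprimep P Q -> defined_at (P%:F / Q%:F) xi -> ratpoly_eval xi Q != 0.
Proof.
move=> Q0 cPQ [R [S [/eqP e Sxi]]].
move: e; rewrite eqr_div ?tofrac_eq0 ?(ratpoly_eval_neq0 Sxi) //.
rewrite -!tofracM tofrac_eq => /eqP e.
(* [Q] divides [P * S = R * Q] and is coprime to [P]; a zero of [Q] is then a zero of [S]. *)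
have QdS : Q %| S.
  by rewrite -(@Gauss_dvdpr _ S P Q) 1?coprimep_sym // e dvdp_mull.
apply: contraNneq Sxi => Qxi0.
by rewrite -[_.[_]]/(ratpoly_eval xi S) -(divpK QdS) rmorphM /= Qxi0 mulr0.
Qed.

Lemma prim_expr_Zp (K : fieldType) (d : nat) (z : K) (m : int) :
  (1 < d)%N -> d.-primitive_root z -> z ^+ (m%:~R : 'Z_d) = z ^ m.
Proof.
move=> d1 pz.
have pos n : z ^+ (n%:R : 'Z_d) = z ^+ n by rewrite val_Zp_nat // prim_expr_mod.
case: m => n; first exact: pos.
have zn0 : z ^+ n.+1 != 0 by rewrite expf_neq0 // (prim_root_eq0 pz) -lt0n ltnW.
(* Multiply by [z ^+ n.+1]: the representatives of the classes of [-(n+1)] and [n+1] add up to 0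
   modulo [d]. *)
apply: (mulIf zn0); rewrite mulVf // NegzE -[z ^+ n.+1]pos -exprD.
rewrite -(prim_expr_mod pz) -[X in (_ %% X)%N](Zp_cast d1).
by rewrite -[(_ %% _)%N]/(val ((- n.+1%:Z)%:~R + n.+1%:R : 'Z_d)) rmorphN addNr.
Qed.

(** As [z] is a root of ['X^d - 1], some ['Phi_k] with [k] dividing [d] vanishes at [z]. Then
    [z ^+ k = 1], so [d] divides [k] and [k = d]. *)
Lemma root_Cyclotomic (K : numFieldType) d (z : K) :
  d.-primitive_root z -> root (map_poly intr 'Phi_d) z.
Proof.
move=> pz; have d0 := prim_order_gt0 pz.
have : root (map_poly intr ('X^d - 1)) z.
  by rewrite rmorphB rmorph1 /= map_polyXn /root !hornerE prim_expr_order // subrr.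
rewrite -prod_Cyclotomic // rmorph_prod /root horner_prod prodf_seq_eq0.
case/hasP=> k; rewrite -dvdn_divisors // => kd /andP[_ rk].
suff <- : k = d by [].
have k0 : (0 < k)%N by apply: dvdn_gt0 kd.
apply/eqP; rewrite eqn_dvd kd /= (prim_order_dvd pz) -subr_eq0.
have : map_poly (intr : int -> K) ('X^k - 1) = 'X^k - 1.
  by rewrite rmorphB rmorph1 /= map_polyXn.
move=> /(congr1 (horner^~ z)); rewrite !hornerE => <-.
rewrite -prod_Cyclotomic // rmorph_prod horner_prod prodf_seq_eq0.
by apply/hasP; exists k; rewrite // -dvdn_divisors.
Qed.

(* Irreducibility of Phi_d over Q, transferred from the algebraic numbers: a
   common divisor of p and Phi_d vanishes at some algebraic primitive d-th root
   of unity, whose minimal polynomial is Phi_d. *)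
Lemma Phi_dvdP (K : numFieldType) d (z : K) (p : {poly rat}) :
  d.-primitive_root z -> reflect (ratpoly_eval z p = 0) (Phi d %| p).
Proof.
move=> pz; have d0 := prim_order_gt0 pz.
have Phi_map (L : numFieldType) : map_poly (@ratr L) (Phi d) = map_poly intr 'Phi_d.
  by rewrite -map_poly_comp; apply: eq_map_poly => c; apply: ratr_int.
have Phiz : ratpoly_eval z (Phi d) = 0.
  by apply/rootP; rewrite Phi_map root_Cyclotomic.
apply: (iffP idP) => [/divpK <- | pz0]; first by rewrite rmorphM /= Phiz mulr0.
set g := gcdp p (Phi d).
(* Over [K] the gcd has the root [z], so it is not a nonzero constant; hence it has a root in
   [algC], although [z] itself need not lie there. *)
have [y] : exists y : algC, root (map_poly ratr g) y.
  apply/closed_rootP; rewrite size_map_poly; apply/negP => /eqP g1.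
  have : root (map_poly (@ratr K) g) z.
    by rewrite gcdp_map root_gcd; apply/andP; split; apply/rootP.
  have gC := size1_polyC (eq_leq g1).
  rewrite gC map_polyC rootC fmorph_eq0 => /eqP c0.
  by move: g1; rewrite gC c0 size_poly0.
rewrite gcdp_map root_gcd Phi_map => /andP[py].
have [w pw] := C_prim_root_exists d0.
rewrite (Cintr_Cyclotomic pw) root_cyclotomic // => yd.
have [q [qy _] qP] := minCpolyP y; rewrite qP in py.
suff -> : Phi d = q by [].
apply: (map_poly_inj (@ratr algC)).
by rewrite Phi_map (Cintr_Cyclotomic yd) -(minCpoly_cyclotomic yd).
Qed.

Lemma zext_phi (d : nat) (V : zmodType) (h : 'Z_d -> V) (a : ZZo) :
  zext h (phi d a) = zext (h \o residue d) a.
Proof. by rewrite raddf_zext; apply: eq_zext => m /=; rewrite zextU. Qed.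

Theorem theorem1p1 (C : numClosedFieldType) (alpha : ZZo) (d : nat)
    (zeta : C) (f : Qx) :
  (1 < d)%N ->
  d.-primitive_root zeta ->
  phi d alpha = 0 ->
  (forall m : nzint, m \in msupp alpha -> defined_at f (zeta ^ (m : int))) ->
  is_factor (Phi d) (powact alpha f).
Proof.
move=> d1 pz phi0 fdef.
have d0 : (0 < d)%N by apply: ltnW.
have z0 : zeta != 0 by rewrite (prim_root_eq0 pz) -lt0n.
have [P [Q [fE Q0 cPQ]]] := Qx_coprimeE f.
(* [h] is total on residues: where the denominator vanishes, its inverse is 0 by convention.
   Residues of elements of the support avoid this case. *)
pose h (r : 'Z_d) := ratpoly_eval (zeta ^+ r) P / ratpoly_eval (zeta ^+ r) Q.
have : takes_value (powact alpha f) zeta (zext (h \o residue d) alpha).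
  apply: takes_value_powact => m /fdef; rewrite fE => fm.
  rewrite /h /residue /= prim_expr_Zp //.
  by apply: takes_value_powsubst => //; apply: defined_at_coprime fm.
(* The value at [zeta] is the linear extension of [h] applied to [phi d alpha = 0], so [A] vanishes
   at [zeta] while [B] does not. *)
rewrite -zext_phi phi0 raddf0 => -[A [B [-> B0 /esym/eqP]]].
rewrite mulf_eq0 invr_eq0 (negbTE B0) orbF => /eqP A0.
exists A, B; split=> //; first exact/(Phi_dvdP _ _ _ _ pz).
by apply: contraNN B0 => /(Phi_dvdP _ _ _ _ pz) ->.
Qed.
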